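(* Let $d\ge1$ be an integer, $\epsilon_c>0$, $\delta\in(0,0.5]$, and $\mathbb{X}=\{x\in\mathbb{R}^d:\|x\|_2\le1\}$. If $\epsilon_c\le O(1)$ and $n>\max\big\{16\log(1/\delta),\ \frac{2^{d+7}\log(1/\delta)}{(e^{\epsilon_c}-1)^2}\big\}$, then there exists a randomizer $\mathcal{R}:\mathbb{X}\to\mathbb{R}^d$ such that $\mathcal{S}\circ\mathcal{R}(X)$ and $\mathcal{S}\circ\mathcal{R}(X')$ are $(\epsilon_c,\delta)$-indistinguishable for all neighboring datasets $X,X'\in\mathbb{X}^n$, and $$\max_{x\in\mathbb{X}}\mathbb{E}\big[\|\mathcal{R}(x)-x\|_2^2\big]\ \le\ O\Bigg(\Big(\frac{\log(1/\delta)}{n\,\epsilon_c^2}\Big)^{\frac{2}{d+2}}\Bigg).$$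
   Context: A randomizer $\mathcal{R}:\mathbb{X}\to\mathbb{R}^{d}$ is a randomized map. For $X=(x_1,\dots,x_n)\in\mathbb{X}^n$, $\mathcal{S}\circ\mathcal{R}(X)=\mathcal{S}(\mathcal{R}(x_1),\dots,\mathcal{R}(x_n))$, where $\mathcal{R}$ is applied with independent randomness to each entry and the shuffler $\mathcal{S}$ applies a uniformly random permutation to its $n$ inputs. Neighboring datasets are datasets of the same size $n$ differing in only one element. Two random variables with laws $P,Q$ are $(\epsilon_c,\delta)$-indistinguishable if $\max(D_{\epsilon_c}(P\|Q),D_{\epsilon_c}(Q\|P))\le\delta$, where $D_\epsilon(P\|Q)=\int\max\{0,P(z)-e^\epsilon Q(z)\}\,dz$. The hypothesis $\epsilon_c\le O(1)$ means $\epsilon_c\le K$ for some fixed constant $K$; the $O(\cdot)$ in the conclusion hides a constant that may depend on $K$ but not on $d,n,\delta,\epsilon_c$. $\log$ is the natural logarithm. *)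

(* Defs.v *)
From HB Require Import structures.
From mathcomp Require Import all_boot all_order all_algebra all_fingroup.
From mathcomp Require Import all_classical all_reals all_analysis.

Set Implicit Arguments.
Unset Strict Implicit.
Unset Printing Implicit Defensive.

Import Order.TTheory GRing.Theory Num.Theory.
Import numFieldNormedType.Exports.

Local Open Scope classical_set_scope.
Local Open Scope ring_scope.

(* R^d is d.-tuple R, whose library sigma-algebra is generated by the
   coordinate maps, i.e. the Borel sigma-algebra. *)
Definition l2norm (R : realType) (d : nat) (x : d.-tuple R) : R :=
  Num.sqrt (\sum_(i < d) tnth x i ^+ 2).

Definition tuple_sub (R : realType) (d : nat) (x y : d.-tuple R) : d.-tuple R :=
  [tuple tnth x i - tnth y i | i < d].

Definition unit_ball (R : realType) (d : nat) : Type :=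
  {x : d.-tuple R | l2norm x <= 1}.

(* A randomized map is given by the law of its output at each input. *)
Definition randomizer (R : realType) (d : nat) : Type :=
  unit_ball R d -> probability (d.-tuple R) R.

Section product_law.
Context {dT : measure_display} {T : measurableType dT} {R : realType}.

Definition cons_pair (n : nat) (xt : T * n.-tuple T) : n.+1.-tuple T :=
  [tuple of xt.1 :: xt.2].

Lemma measurable_cons_pair n : measurable_fun [set: T * n.-tuple T] (@cons_pair n).
Proof. by apply: measurable_cons. Qed.

HB.instance Definition _ n :=
  @isMeasurableFun.Build _ _ _ _ (@cons_pair n) (@measurable_cons_pair n).

(* Law of (y_0, .., y_(n-1)) for independent y_i of respective laws P i. *)
Fixpoint product_law (n : nat) : ('I_n -> probability T R) ->
    probability (n.-tuple T) R :=
  match n with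
  | 0%N => fun _ => \d_([tuple] : 0.-tuple T)
  | m.+1 => fun P =>
      distribution (P ord0 \x product_law (fun i => P (lift ord0 i)))%E
        (@cons_pair m)
  end.

End product_law.

Section shuffler.
Context {dT : measure_display} {T : measurableType dT} {R : realType}.
Variable n : nat.

Definition permute (s : 'S_n) (y : n.-tuple T) : n.-tuple T :=
  [tuple tnth y (s i) | i < n].

Lemma measurable_permute s : measurable_fun [set: n.-tuple T] (permute s).
Proof.
apply/measurable_fun_tnthP => i.
rewrite (_ : _ \o _ = @tnth n T ^~ (s i)); first exact: measurable_tnth.
by apply/funext => y /=; rewrite tnth_mktuple.
Qed.

HB.instance Definition _ s :=
  @isMeasurableFun.Build _ _ _ _ (permute s) (measurable_permute s).

Variable P : probability (n.-tuple T) R.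

(* Law of the permuted tuple when the tuple has law P and the permutation is
   uniform on 'S_n and independent of it. *)
Definition shuffle_law (A : set (n.-tuple T)) : \bar R :=
  ((n`!%:R^-1)%:E * \sum_(s : 'S_n) distribution P (permute s) A)%E.

Let shuffle_law0 : shuffle_law set0 = 0%E.
Proof.
by rewrite /shuffle_law big1 ?mule0// => s _; rewrite measure0.
Qed.

Let shuffle_law_ge0 A : (0 <= shuffle_law A)%E.
Proof.
by apply: mule_ge0; [rewrite lee_fin invr_ge0|
  apply: sume_ge0 => s _; exact: measure_ge0].
Qed.

Let shuffle_law_sigma_additive : semi_sigma_additive shuffle_law.
Proof.
move=> F mF tF mUF.
under eq_cvg => k.
  rewrite -ge0_sume_distrr; last first.
    by move=> i _; apply: sume_ge0 => s _; exact: measure_ge0.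
  rewrite exchange_big; over.
apply: cvgeZl => //; apply: cvg_nnesum => s _.
  by near=> k; apply: sume_ge0 => i _; exact: measure_ge0.
exact: measure_semi_sigma_additive.
Unshelve. all: by end_near. Qed.

HB.instance Definition _ := isMeasure.Build _ _ _ shuffle_law
  shuffle_law0 shuffle_law_ge0 shuffle_law_sigma_additive.

Let shuffle_law_setT : shuffle_law [set: _] = 1%E.
Proof.
rewrite /shuffle_law (eq_bigr (fun=> 1%E)); last first.
  by move=> s _; exact: probability_setT.
have <- : ((\sum_(s : 'S_n) (1 : R))%:E = \sum_(s : 'S_n) 1)%E by rewrite -sumEFin.
by rewrite sumr_const card_Sn -EFinM mulVf.
Qed.

HB.instance Definition _ :=
  Measure_isProbability.Build _ _ _ shuffle_law shuffle_law_setT.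

End shuffler.

Definition shuffled_output (R : realType) (d n : nat) (A : randomizer R d)
    (X : n.-tuple (unit_ball R d)) : probability (n.-tuple (d.-tuple R)) R :=
  shuffle_law (product_law (fun i => A (tnth X i))).

Definition neighboring (T : Type) (n : nat) (X X' : n.-tuple T) : Prop :=
  exists i : 'I_n, tnth X i <> tnth X' i /\
    forall j : 'I_n, j != i -> tnth X j = tnth X' j.

Section indistinguishability.
Context {dT : measure_display} {T : measurableType dT} {R : realType}.

Section sum_measure.
Variables P Q : probability T R.

Definition sum_law : set T -> \bar R := measure_add P Q.

HB.instance Definition _ := Measure.on sum_law.

Let sum_law_finite : fin_num_fun sum_law.
Proof.
by move=> A mA; rewrite /sum_law measure_addE fin_numD !fin_num_measure.
Qed.

HB.instance Definition _ := @Measure_isFinite.Build _ _ _ sum_law sum_law_finite.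

End sum_measure.

(* int max(0, P(z) - e^eps Q(z)) dz, with the densities taken with respect to
   the reference measure P + Q, which dominates both laws; the value does not
   depend on the dominating measure (Lebesgue measure, when P and Q have
   Lebesgue densities). *)
Definition hockey_stick (eps : R) (P Q : probability T R) : \bar R :=
  let p := Radon_Nikodym (charge_of_finite_measure P) (sum_law P Q) in
  let q := Radon_Nikodym (charge_of_finite_measure Q) (sum_law P Q) in
  (\int[sum_law P Q]_z maxe 0 (p z - (expR eps)%:E * q z))%E.

Definition indistinguishable (eps delta : R) (P Q : probability T R) : Prop :=
  (maxe (hockey_stick eps P Q) (hockey_stick eps Q P) <= delta%:E)%E.

End indistinguishability.

Definition mean_squared_error (R : realType) (d : nat) (A : randomizer R d)
    (x : unit_ball R d) : \bar R :=
  'E_(A x)[fun z => l2norm (tuple_sub z (sval x)) ^+ 2].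

(* Main.v *)
From HB Require Import structures.
Require Import Defs.
From mathcomp Require Import all_boot all_order all_algebra all_fingroup.
From mathcomp Require Import all_classical all_reals all_analysis.
From mathcomp Require Import measurable_realfun ring lra.

(* With t = log(1/delta) / (n eps^2), choose a radius r proportional to
   t^(1/(d+2)). If r > 1 a constant randomizer is accurate enough. Otherwise
   let N be the image of the unit ball under rounding toward zero on the grid
   of step r / sqrt d: every point is within r of its rounding, N lies in the
   ball, and |N| <= (4e/r)^d. The randomizer outputs the rounding of x with
   probability 1 - r^2 and a uniform point of N (the "blanket") with
   probability r^2, so its squared error is at most 5 r^2.

   For privacy, let the differing user report a in one dataset and b in the
   other, and let N_a, N_b count the other users whose blanket sample is a,
   resp. b. Exchanging the samples a and b of one user and then permuting that
   user with the differing one turns one dataset into the other, whence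
   E[f; a] - e^eps E[f; b] <= P(1 + N_a > e^eps N_b) for symmetric f with
   values in [0, 1]; a Chernoff bound shows that this is at most delta as soon
   as n (r^2 / |N|) eps^2 >= const * log(1/delta). *)

Set Implicit Arguments.
Unset Strict Implicit.
Unset Printing Implicit Defensive.

Import Order.TTheory GRing.Theory Num.Theory.
Local Open Scope classical_set_scope.
Local Open Scope ring_scope.

(** * Bounding the hockey-stick divergence *)

Section hockey_stick_bound.
Context {dT : measure_display} {T : measurableType dT} {R : realType}.
Local Open Scope ereal_scope.

Lemma sum_law_dominatesl (P Q : probability T R) :
  charge_of_finite_measure P `<< sum_law P Q.
Proof.
apply/null_content_dominatesP => A mA; rewrite /sum_law.
rewrite [X in X = _ -> _](measure_addE P Q A) => PQ0.
by apply/eqP; rewrite eq_le measure_ge0 andbT -PQ0 leeDl.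
Qed.

Lemma sum_law_dominatesr (P Q : probability T R) :
  charge_of_finite_measure Q `<< sum_law P Q.
Proof.
apply/null_content_dominatesP => A mA; rewrite /sum_law.
rewrite [X in X = _ -> _](measure_addE P Q A) => PQ0.
by apply/eqP; rewrite eq_le measure_ge0 andbT -PQ0 leeDr.
Qed.

(** Integrating the positive part of the density gap means integrating the gap over the event [E]
    where it is nonnegative, so testing events suffices and no density has to be computed. *)
Lemma hockey_stick_le (eps delta : R) (P Q : probability T R) :
  (forall A, measurable A -> P A <= (expR eps)%:E * Q A + delta%:E) ->
  hockey_stick eps P Q <= delta%:E.
Proof.
move=> PQ; rewrite /hockey_stick /=.
set mu := sum_law P Q.
set p := Radon_Nikodym (charge_of_finite_measure P) mu.
set q := Radon_Nikodym (charge_of_finite_measure Q) mu.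
have ip : mu.-integrable setT p.
  exact/Radon_Nikodym_integrable/sum_law_dominatesl.
have iq : mu.-integrable setT q.
  exact/Radon_Nikodym_integrable/sum_law_dominatesr.
have ieq : mu.-integrable setT (fun z => (expR eps)%:E * q z).
  exact: integrableZl.
have ipq : mu.-integrable setT (fun z => p z - (expR eps)%:E * q z).
  exact: integrableB.
pose E := [set z | 0 <= p z - (expR eps)%:E * q z].
have mE : measurable E.
  rewrite -[E]setTI; apply: measurable_lee => //.
  exact: measurable_int ipq.
have -> : \int[mu]_z maxe 0 (p z - (expR eps)%:E * q z) =
    \int[mu]_(z in E) (p z - (expR eps)%:E * q z).
  rewrite [RHS]integral_mkcond; apply: eq_integral => z _.
  rewrite patchE; case: ifPn => [|]; first by rewrite inE => /max_idPr.
  by rewrite notin_setE => /negP; rewrite -ltNge => /ltW /max_idPl.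
rewrite integralB //; [|exact: integrableS ip|exact: integrableS ieq].
rewrite integralZl //; last exact: integrableS iq.
rewrite -!Radon_Nikodym_integral//; last 2 first.
- exact: sum_law_dominatesr.
- exact: sum_law_dominatesl.
rewrite leeBlDl ?fin_numM ?fin_num_measure//.
exact: PQ.
Qed.

End hockey_stick_bound.

(** * Finitely supported laws *)

Definition selected (I T : Type) n (v : 'I_n -> I -> T) (s : 'I_n -> I) :
    n.-tuple T :=
  [tuple v i (s i) | i < n].

Section finite_law.
Context {d : measure_display} {T : measurableType d} {R : realType}.
Variables (I : finType) (i0 : I) (w : I -> R) (v : I -> T).
Hypothesis w_ge0 : forall i, 0 <= w i.

(** The randomness sits on the labels [I], and [v] need not be injective: a point may arise both as
    a truthful report and as a blanket sample. [i0] is the default of [nth] when [I] is enumerated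
    for [msum]. *)
Definition finite_law of \sum_i w i = 1 : set T -> \bar R :=
  msum (fun k => mscale (NngNum (w_ge0 (nth i0 (enum I) k)))
                        \d_(v (nth i0 (enum I) k))) #|I|.

Hypothesis w_sum1 : \sum_i w i = 1.

HB.instance Definition _ := Measure.on (finite_law w_sum1).

Lemma sum_nth_enum (V : nmodType) (F : I -> V) :
  (\sum_(k < #|I|) F (nth i0 (enum I) k) = \sum_i F i)%R.
Proof.
transitivity (\sum_(i in I) F i)%R; last exact: eq_bigl.
rewrite [RHS]big_enum_val.
by apply: eq_bigr => k _; rewrite (enum_val_nth i0).
Qed.

Lemma finite_lawE A : finite_law w_sum1 A = (\sum_i w i * \1_A (v i))%:E.
Proof.
rewrite /finite_law /msum /mscale /dirac /= sumEFin.
by rewrite -(sum_nth_enum (fun i => w i * \1_A (v i))).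
Qed.

Let finite_law_setT : finite_law w_sum1 setT = 1%E.
Proof.
by rewrite finite_lawE -w_sum1; under eq_bigr do rewrite indicT mulr1.
Qed.

HB.instance Definition _ :=
  Measure_isProbability.Build _ _ _ (finite_law w_sum1) finite_law_setT.

Lemma integral_finite_law (f : T -> \bar R) : measurable_fun [set: T] f ->
  (forall x, (0 <= f x)%E) ->
  (\int[finite_law w_sum1]_x f x = \sum_i (w i)%:E * f (v i))%E.
Proof.
move=> mf f0.
rewrite ge0_integral_measure_sum//.
rewrite -(sum_nth_enum (fun i => (w i)%:E * f (v i))%E).
apply: eq_bigr => k _.
by rewrite ge0_integral_mscale// integral_dirac// diracT mul1e.
Qed.

End finite_law.

Section product_finite_law.
Context {d : measure_display} {T : measurableType d} {R : realType}.
Variables (I : finType) (i0 : I) (w : I -> R).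
Hypotheses (w_ge0 : forall i, 0 <= w i) (w_sum1 : \sum_i w i = 1).

(** Splitting a selection into head and tail matches the recursion of [product_law]. *)
Lemma sum_ffun_recl n (F : {ffun 'I_n.+1 -> I} -> R) :
  \sum_s F s = \sum_i \sum_(s : {ffun 'I_n -> I})
    F [ffun j => if unlift ord0 j is Some j' then s j' else i].
Proof.
rewrite pair_big/=.
pose h (x : I * {ffun 'I_n -> I}) : {ffun 'I_n.+1 -> I} :=
  [ffun j => if unlift ord0 j is Some j' then x.2 j' else x.1].
rewrite (reindex h)//=; exists (fun s : {ffun 'I_n.+1 -> I} =>
  (s ord0, [ffun j => s (lift ord0 j)])) => [[i s]|s] _ /=.
  rewrite ffunE unlift_none; congr pair.
  by apply/ffunP => j; rewrite !ffunE liftK.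
apply/ffunP => j; rewrite ffunE.
by case: unliftP => [j'|] -> //=; rewrite ffunE.
Qed.

Lemma product_finite_lawE n (v : 'I_n -> I -> T) A : measurable A ->
  product_law (fun i => finite_law i0 (v i) w_ge0 w_sum1 : probability T R) A =
  (\sum_(s : {ffun 'I_n -> I}) (\prod_i w (s i)) * \1_A (selected v s))%:E.
Proof.
elim: n v A => [|n IH] v A mA /=.
  rewrite /dirac; congr EFin.
  rewrite (eq_bigr (fun=> \1_A [tuple])); last first.
    by move=> s _; rewrite big_ord0 mul1r; congr (\1_A _); exact: tuple0.
  by rewrite sumr_const card_ffun card_ord expn0 mulr1n.
rewrite /distribution /pushforward /product_measure1.
rewrite integral_finite_law//=; last first.
  apply: measurable_fun_xsection.
  by rewrite -[X in measurable X]setTI; exact: measurable_cons_pair.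
rewrite sum_ffun_recl -sumEFin; apply: eq_bigr => i _.
rewrite IH; last first.
  apply: measurable_xsection.
  by rewrite -[X in measurable X]setTI; exact: measurable_cons_pair.
rewrite -EFinM mulr_sumr; congr EFin; apply: eq_bigr => s _.
rewrite big_ord_recl ffunE unlift_none mulrA; congr (_ * _ * _).
  by apply: eq_bigr => j _; rewrite ffunE liftK.
rewrite !indicE; congr (_%:R); congr nat_of_bool.
have -> : selected v [ffun j => if unlift ord0 j is Some j' then s j' else i] =
  cons_pair (v ord0 i, selected (fun j => v (lift ord0 j)) s).
  apply: eq_from_tnth => j; rewrite tnth_mktuple ffunE.
  case: unliftP => [j'|] ->; last by rewrite tnth0.
  by rewrite tnthS tnth_mktuple.
by rewrite mem_xsection; apply/idP/idP; rewrite !inE.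
Qed.

End product_finite_law.

(** * Shuffling as averaging over permutations *)

Section symmetrization.
Context {d : measure_display} {T : measurableType d} {R : realType} {n : nat}.

(** The average over permutations is moved from the law onto the test function, which becomes the
    symmetric [f] of the privacy argument. *)
Definition symmetrized_indic (A : set (n.-tuple T)) (y : n.-tuple T) : R :=
  n`!%:R^-1 * \sum_(s : 'S_n) \1_A (permute s y).

Lemma symmetrized_indic_permute A t y :
  symmetrized_indic A (permute t y) = symmetrized_indic A y.
Proof.
congr (_ * _); rewrite [RHS](reindex_inj (mulIg t)) /=.
apply: eq_bigr => s _; congr (\1_A _).
by apply: eq_from_tnth => i; rewrite !tnth_mktuple permM.
Qed.

Lemma symmetrized_indic_ge0 A y : 0 <= symmetrized_indic A y.
Proof. by rewrite mulr_ge0 ?invr_ge0 ?sumr_ge0// => s _; rewrite indicE. Qed.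

Lemma symmetrized_indic_le1 A y : symmetrized_indic A y <= 1.
Proof.
rewrite ler_pdivrMl ?ltr0n ?fact_gt0// mulr1.
rewrite (@le_trans _ _ (\sum_(s : 'S_n) 1))//.
  by apply: ler_sum => s _; rewrite indicE; case: (_ \in _).
by rewrite sumr_const card_Sn.
Qed.

Lemma shuffle_law_finiteE (S : finType) (W : S -> R) (Y : S -> n.-tuple T)
    (P : probability (n.-tuple T) R) :
  (forall A, measurable A -> P A = (\sum_s W s * \1_A (Y s))%:E) ->
  forall A, measurable A ->
    shuffle_law P A = (\sum_s W s * symmetrized_indic A (Y s))%:E.
Proof.
move=> PE A mA; rewrite /shuffle_law.
under eq_bigr => t _.
  rewrite /distribution /pushforward PE; last first.
    by rewrite -[X in measurable X]setTI; exact: measurable_permute.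
  over.
rewrite sumEFin -EFinM exchange_big/= mulr_sumr; congr EFin.
by apply: eq_bigr => s _; rewrite -mulr_sumr mulrCA.
Qed.
End symmetrization.

(** * Privacy blanket *)

Section blanket.
Context {dT : measure_display} {R : realType} {J : finType} {T : measurableType dT}
  {n : nat}.
Variables (w : option J -> R) (pt : J -> T) (i : 'I_n) (a b : J).
Variable q : R.
Hypotheses (w_ge0 : forall o, 0 <= w o) (wq : forall c, w (Some c) = q).
Hypothesis ab : a != b.
Implicit Types (h : 'I_n -> J) (s : {ffun 'I_n -> option J}).

(** The selection [s] is the noise, drawn independently of the data; the dataset enters only through
    the truthful reports [h]. *)
Definition outcome h s : n.-tuple T :=
  selected (fun j o => pt (odflt (h j) o)) s.

(** These are the counts N_a and N_b; leaving out the differing user [i] makes them independent of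
    [s i]. *)
Definition hits c s : nat := \sum_(j | j != i) (s j == Some c).

Let swap (j : 'I_n) s : {ffun 'I_n -> option J} :=
  [ffun l => if l == j then tperm (Some a) (Some b) (s l) else s l].

Let swapK j : involutive (swap j).
Proof.
by move=> s; apply/ffunP => l; rewrite !ffunE; case: eqP => // _; rewrite tpermK.
Qed.

Let prod_swap j s : \prod_l w (swap j s l) = \prod_l w (s l).
Proof.
apply: eq_bigr => l _; rewrite ffunE; case: eqP => // _.
by case: tpermP => [->|->|//]; rewrite !wq.
Qed.

(** Source of the [.+1] in the bounds: after the exchange user [j] no longer holds [a], so N_a + 1
    there equals N_a before. *)
Let hits_swap j s : j != i -> s j = Some a ->
  (hits a (swap j s)).+1 = hits a s.
Proof.
move=> ji sj; rewrite /hits (bigD1 j)//= [RHS](bigD1 j)//=.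
rewrite !ffunE eqxx sj tpermL eqxx /= (inj_eq Some_inj) eq_sym (negbTE ab).
rewrite add0n add1n.
congr _.+1; apply: eq_bigr => l /andP[_ lj].
by rewrite ffunE (negbTE lj).
Qed.

Let outcome_swap h h' j s : j != i -> s j = Some a -> s i = None ->
  h i = a -> h' i = b -> (forall l, l != i -> h l = h' l) ->
  outcome h (swap j s) = permute (tperm i j) (outcome h' s).
Proof.
move=> ji sj si hi hi' hh'.
have ij : (i == j) = false by rewrite eq_sym (negbTE ji).
apply: eq_from_tnth => l; rewrite !tnth_mktuple ffunE.
case: (tpermP i j l) => [->|->|/eqP li /eqP lj].
- by rewrite ij sj si /= hi.
- by rewrite eqxx sj tpermL si /= hi'.
- by rewrite (negbTE lj) hh'.
Qed.

(* Exchanging the blanket samples a and b of user j, then users i and j, maps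
   (outcome h' s, s j = Some a) to (outcome h s, s j = Some b); sum over j. *)
Lemma blanket_swap h h' (f : n.-tuple T -> R) :
  h i = a -> h' i = b -> (forall l, l != i -> h l = h' l) ->
  (forall t y, f (permute t y) = f y) ->
  \sum_(s : {ffun 'I_n -> option J} | s i == None)
     (\prod_l w (s l)) * f (outcome h s) * ((hits b s)%:R / (hits a s).+1%:R) =
  \sum_(s : {ffun 'I_n -> option J} | s i == None)
     (\prod_l w (s l)) * f (outcome h' s) * (0 < hits a s)%N%:R.
Proof.
move=> hi hi' hh' fsym.
(* [G] spreads N_b over the users holding [b]; [H] writes the indicator of N_a > 0 as N_a / N_a and
   spreads the numerator over the users holding [a]. *)
pose G j s : R := (s j == Some b)%:R * ((\prod_l w (s l)) * f (outcome h s) /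
     (hits a s).+1%:R).
pose H j s : R := (s j == Some a)%:R * ((\prod_l w (s l)) * f (outcome h' s) /
     (hits a s)%:R).
transitivity (\sum_(s : {ffun 'I_n -> option J} | s i == None)
  \sum_(j | j != i) G j s).
  apply: eq_bigr => s _; rewrite -mulr_suml -natr_sum -/(hits b s).
  by rewrite mulrCA mulrA.
transitivity (\sum_(s : {ffun 'I_n -> option J} | s i == None)
  \sum_(j | j != i) H j s); last first.
  apply: eq_bigr => s _; rewrite -mulr_suml -natr_sum -/(hits a s).
  rewrite mulrCA; congr (_ * _).
  by case: (hits a s) => [|k]; rewrite ?mul0r// divff.
rewrite exchange_big [RHS]exchange_big; apply: eq_bigr => j ji.
have ij : (i == j) = false by rewrite eq_sym (negbTE ji).
rewrite (reindex_inj (inv_inj (swapK j))) /=.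
apply: eq_big => [s|s].
  by rewrite ffunE ij.
rewrite ffunE ij => /eqP si; rewrite /G /H.
have -> : (swap j s j == Some b) = (s j == Some a).
  rewrite ffunE eqxx; case: tpermP => [->|->|].
  - by rewrite !eqxx.
  - by rewrite eq_sym.
  - by move=> /eqP/negbTE -> /eqP/negbTE ->.
have [sj|] := eqVneq (s j) (Some a); last by rewrite !mul0r.
by rewrite prod_swap hits_swap// (outcome_swap (h' := h'))// fsym.
Qed.

(** If user [i] draws from the blanket, both datasets give the same outcome. Otherwise, either e N_b
    / (N_a + 1) >= 1 and inserting this factor leads to [blanket_swap], or [f <= 1] charges the term
    to the bad event. *)
Lemma blanket_le h h' (f : n.-tuple T -> R) (e : R) :
  h i = a -> h' i = b -> (forall l, l != i -> h l = h' l) ->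
  (forall t y, f (permute t y) = f y) ->
  (forall y, 0 <= f y <= 1) -> 1 <= e ->
  \sum_(s : {ffun 'I_n -> option J}) (\prod_l w (s l)) * f (outcome h s) <=
  e * \sum_(s : {ffun 'I_n -> option J}) (\prod_l w (s l)) * f (outcome h' s) +
  \sum_(s : {ffun 'I_n -> option J})
    (\prod_l w (s l)) * (e * (hits b s)%:R < (hits a s).+1%:R)%R%:R.
Proof.
move=> hi hi' hh' fsym f01 e1.
have W0 s : 0 <= \prod_l w (s l) by rewrite prodr_ge0.
have f0 y : 0 <= f y by case/andP: (f01 y).
have f1 y : f y <= 1 by case/andP: (f01 y).
have e0 : 0 <= e by rewrite (le_trans _ e1).
rewrite (bigID (fun s : {ffun 'I_n -> option J} => s i == None)) /=.
rewrite [in leRHS](bigID (fun s : {ffun 'I_n -> option J} => s i == None)) /=.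
set X := \sum_(s : {ffun 'I_n -> option J} | s i == None) _.
set Y := \sum_(s : {ffun 'I_n -> option J} | s i != None) _.
set X' := \sum_(s : {ffun 'I_n -> option J} | s i == None) _.
set Y' := \sum_(s : {ffun 'I_n -> option J} | s i != None) _.
set Z := \sum_s _.
have YY' : Y = Y'.
  apply: eq_bigr => s si; congr (_ * f _).
  apply: eq_from_tnth => l; rewrite !tnth_mktuple.
  by have [->|li] := eqVneq l i; [case: (s i) si|rewrite hh'].
have Y0 : 0 <= Y' by apply: sumr_ge0 => s _; rewrite mulr_ge0.
have YeY : Y <= e * Y' by rewrite YY' ler_peMl.
suff : X <= e * X' + Z by rewrite mulrDr; lra.
have : \sum_(s : {ffun 'I_n -> option J} | s i == None)
    (\prod_l w (s l)) * f (outcome h s) *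
     ((hits b s)%:R / (hits a s).+1%:R) <= X'.
  rewrite (blanket_swap hi hi' hh' fsym); apply: ler_sum => s _.
  by rewrite ler_piMr ?mulr_ge0//; case: (0 < _)%N.
move/(ler_wpM2l e0).
suff : X <= e * (\sum_(s : {ffun 'I_n -> option J} | s i == None)
    (\prod_l w (s l)) * f (outcome h s) *
     ((hits b s)%:R / (hits a s).+1%:R)) + Z by lra.
rewrite [Z](bigID (fun s : {ffun 'I_n -> option J} => s i == None)) /=.
rewrite addrA mulr_sumr -big_split /= ler_wpDr ?sumr_ge0// => [s _|].
  by rewrite mulr_ge0.
apply: ler_sum => s _.
rewrite mulrCA -mulrA -mulrDr ler_wpM2l//.
have hp : 0 < (hits a s).+1%:R :> R by rewrite ltr0n.
case: ltP => h1; rewrite /= ?addr0 ?mulr1n.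
  by rewrite (le_trans (f1 _))// lerDr !mulr_ge0// invr_ge0 ltW.
by rewrite ler_peMr// mulrA ler_pdivlMr// mul1r.
Qed.

(** The indicator is at most exp(lam (1 + N_a - e N_b)), whose mean factors over independent users;
    each factor 1 + x is then bounded by exp x. *)
Lemma blanket_chernoff (lam e : R) : 0 <= lam -> \sum_o w o = 1 ->
  \sum_(s : {ffun 'I_n -> option J})
    (\prod_l w (s l)) * (e * (hits b s)%:R < (hits a s).+1%:R)%R%:R <=
  expR (lam + n.-1%:R * (q * (expR lam + expR (- (lam * e)) - 2))).
Proof.
move=> lam0 w1.
pose phi (o : option J) : R := lam * ((o == Some a)%:R - e * (o == Some b)%:R).
have step : \sum_o w o * expR (phi o) =
    1 + q * (expR lam + expR (- (lam * e)) - 2).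
  rewrite -[X in _ = X + _]w1 -[LHS](subrK (\sum_o w o)) -sumrB addrC.
  congr (_ + _).
  under eq_bigr do rewrite -[X in _ - X]mulr1 -mulrBr.
  rewrite (bigD1 (Some a))//= (bigD1 (Some b))/=; last first.
    by rewrite (inj_eq Some_inj) eq_sym.
  rewrite big1 => [|o /andP[oa ob]]; last first.
    by rewrite /phi (negbTE oa) (negbTE ob) mulr0 subrr mulr0 expR0 subrr mulr0.
  rewrite !wq /phi !eqxx !(inj_eq Some_inj) (negbTE ab) eq_sym (negbTE ab).
  rewrite mulr0 subr0 mulr1 sub0r mulr1 mulrN addr0 -mulrDr.
  by congr (_ * _); ring.
have hitsE c s : (hits c s)%:R = \sum_(l | l != i) (s l == Some c)%:R :> R.
  by rewrite /hits natr_sum.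
(* User [i] is not counted, so its factor is 1 and only [n.-1] exponential factors remain. *)
apply: (@le_trans _ _ (\sum_(s : {ffun 'I_n -> option J})
    expR lam * \prod_l (w (s l) * (if l == i then 1 else expR (phi (s l)))))).
  apply: ler_sum => s _; rewrite big_split /= mulrCA.
  rewrite ler_wpM2l ?prodr_ge0//.
  rewrite (bigD1 i)//= eqxx mul1r.
  rewrite (eq_bigr (fun l => expR (phi (s l)))); last first.
    by move=> l /negbTE ->.
  rewrite -expR_sum -expRD -mulr_sumr sumrB -mulr_sumr -!hitsE.
  case: ltP => h; last by rewrite expR_ge0.
  rewrite -[leLHS]expR0 ler_expR -{1}[lam]mulr1 -mulrDr.
  rewrite mulr_ge0// addrA subr_ge0.
  by rewrite (le_trans (ltW h))// -natr1 addrC.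
rewrite -mulr_sumr.
rewrite -(bigA_distr_bigA (fun l o =>
  w o * (if l == i then 1 else expR (phi o)))).
rewrite (bigD1 i)//= eqxx.
under eq_bigr do rewrite mulr1.
rewrite w1 mul1r.
rewrite (eq_bigr (fun=> 1 + q * (expR lam + expR (- (lam * e)) - 2))); last first.
  by move=> l /negbTE li; rewrite -step; apply: eq_bigr => o _; rewrite li.
rewrite prodr_const cardC1 card_ord expRD ler_wpM2l ?expR_ge0//.
rewrite expRM_natl lerXn2r ?nnegrE ?expR_ge0 ?expR_ge1Dx//.
by rewrite -step sumr_ge0// => o _; rewrite mulr_ge0 ?expR_ge0.
Qed.

End blanket.

(** * Estimates for the Chernoff exponent *)

Section exponent.
Context {R : realType}.

(** Compare with 1 / (1 - x), an upper bound for exp x when x < 1. *)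
Lemma expR_le_quadratic (x : R) : x <= 2^-1 -> expR x <= 1 + x + 2 * x ^+ 2.
Proof.
move=> x2; have x1 : 0 < 1 - x by lra.
have : expR x <= (1 - x)^-1.
  by rewrite -[x in leLHS]opprK expRN lef_pV2 ?posrE ?expR_gt0// expR_ge1Dx.
move=> /le_trans; apply; rewrite -[leLHS]mul1r ler_pdivrMr//.
have x0 : 0 <= x ^+ 2 by exact: sqr_ge0.
have : 0 <= x ^+ 2 * (1 - 2 * x) by rewrite mulr_ge0//; lra.
have -> : x ^+ 2 * (1 - 2 * x) = (1 + x + 2 * x ^+ 2) * (1 - x) - 1 by ring.
by rewrite subr_ge0.
Qed.

(** With L = 1 + exp(2K), this is the maximizer of lam * eps - 2 lam^2 L. *)
Definition chernoff_param (K eps : R) : R := eps / (4 * (1 + expR (2 * K))).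

Lemma chernoff_param_le2V (K eps : R) : 0 < eps -> eps <= K ->
  chernoff_param K eps <= 2^-1.
Proof.
move=> e0 eK; rewrite /chernoff_param ler_pdivrMr; last first.
  by have := expR_ge0 (2 * K); lra.
have := expR_ge1Dx (2 * K); lra.
Qed.

(** Apply the quadratic bound at lam and at -lam exp(eps): the linear terms give at most -lam * eps,
    the quadratic ones at most 2 lam^2 L, since eps <= K. *)
Lemma chernoff_exponent_le (K eps : R) : 0 < eps -> eps <= K ->
  expR (chernoff_param K eps) + expR (- (chernoff_param K eps * expR eps)) - 2 <=
  - (eps ^+ 2 / (8 * (1 + expR (2 * K)))).
Proof.
move=> e0 eK; set lam := chernoff_param K eps; set L := 1 + expR (2 * K).
have L2 : 2 <= L by rewrite /L -lerBlDl (le_trans _ (expR_ge1Dx _))//; lra.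
have L0 : 0 < L by lra.
have lam0 : 0 <= lam by rewrite divr_ge0// -/L; lra.
have lam2 : lam <= 2^-1 by exact: chernoff_param_le2V.
have E1 : 1 + eps <= expR eps by exact: expR_ge1Dx.
have E2 : expR eps ^+ 2 <= L - 1.
  by rewrite /L addrAC subrr add0r -expRM_natl ler_expR; lra.
have h1 := expR_le_quadratic lam2.
have /expR_le_quadratic h2 : - (lam * expR eps) <= 2^-1.
  by rewrite (@le_trans _ _ 0)// oppr_le0 mulr_ge0// expR_ge0.
have lamE : eps = 4 * L * lam by rewrite /lam /chernoff_param -/L; field; lra.
have -> : eps ^+ 2 / (8 * L) = lam * eps - 2 * lam ^+ 2 * L.
  by rewrite lamE; field; lra.
have : lam * (1 + eps) <= lam * expR eps by rewrite ler_wpM2l.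
have : lam ^+ 2 * expR eps ^+ 2 <= lam ^+ 2 * (L - 1).
  by rewrite ler_wpM2l// sqr_ge0.
rewrite sqrrN exprMn in h2; lra.
Qed.
(** This lower bound lets log(1/delta) absorb additive constants. *)
Lemma ln_inv_ge (delta : R) : 0 < delta -> delta <= 2^-1 ->
  2^-1 <= ln (1 / delta).
Proof.
move=> d0 d2.
rewrite -ler_expR lnK ?posrE ?divr_gt0// div1r.
have : expR (2^-1) <= (2 : R).
  have := expR_ge1Dx (- (2^-1 : R)); rewrite expRN => h2.
  rewrite -lef_pV2 ?posrE ?expR_gt0// (le_trans _ h2)//; lra.
move=> /le_trans; apply; rewrite -[leLHS]invrK lef_pV2 ?posrE//; lra.
Qed.

End exponent.

(** * A net of the unit ball *)

Lemma sum_option (V : nmodType) (J : finType) (F : option J -> V) :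
  \sum_o F o = F None + \sum_c F (Some c).
Proof.
rewrite (bigD1 None)//=; congr (_ + _).
rewrite (reindex_omap Some id) /=; last by case.
by apply: eq_bigl => c; rewrite eqxx.
Qed.

Section euclidean.
Context {R : realType} {d : nat}.
Implicit Types x y : d.-tuple R.

Lemma l2norm_sqr x : l2norm x ^+ 2 = \sum_(i < d) tnth x i ^+ 2.
Proof. by rewrite sqr_sqrtr// sumr_ge0// => i _; exact: sqr_ge0. Qed.

Lemma l2norm_le1 x : (l2norm x <= 1) = (\sum_(i < d) tnth x i ^+ 2 <= 1).
Proof.
rewrite -l2norm_sqr -[X in _ = (_ <= X)](expr1n _ 2).
by rewrite ler_pXn2r// nnegrE ?sqrtr_ge0.
Qed.

Lemma sqr_tuple_sub x y :
  l2norm (tuple_sub x y) ^+ 2 = \sum_(i < d) (tnth x i - tnth y i) ^+ 2.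
Proof. by rewrite l2norm_sqr; apply: eq_bigr => i _; rewrite tnth_mktuple. Qed.

Lemma sqr_tuple_sub_le4 x y : l2norm x <= 1 -> l2norm y <= 1 ->
  l2norm (tuple_sub x y) ^+ 2 <= 4.
Proof.
rewrite !l2norm_le1 sqr_tuple_sub => x1 y1.
have : \sum_(i < d) (tnth x i - tnth y i) ^+ 2 <=
    \sum_(i < d) (2 * tnth x i ^+ 2 + 2 * tnth y i ^+ 2).
  apply: ler_sum => i _; have := sqr_ge0 (tnth x i + tnth y i).
  rewrite !expr2; lra.
rewrite big_split/= -!mulr_sumr; lra.
Qed.

Lemma measurable_sqr_tuple_sub y :
  measurable_fun [set: d.-tuple R] (fun x => l2norm (tuple_sub x y) ^+ 2).
Proof.
under eq_fun do rewrite sqr_tuple_sub.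
apply: measurable_sum => i; apply: measurable_funX.
by apply: measurable_funB => //; exact: measurable_tnth.
Qed.

End euclidean.

Section net.
Context {R : realType}.
Variables (d : nat) (r : R).
Hypotheses (d_gt0 : (0 < d)%N) (r_gt0 : 0 < r) (r_le1 : r <= 1).

(** A cube of this side has diagonal [r]. *)
Definition net_step : R := r / Num.sqrt d%:R.

Definition net_code : finType :=
  {ffun 'I_d -> bool * 'I_(Num.trunc (net_step^-1)).+1}.

Definition net_point (z : net_code) : d.-tuple R :=
  [tuple (-1) ^+ (z i).1 * (net_step * ((z i).2 : nat)%:R) | i < d].

(** Truncating the magnitude apart from the sign rounds toward zero; on the unit ball [inord] stays
    in range. *)
Definition round_code (x : d.-tuple R) : net_code :=
  [ffun i => (tnth x i < 0, inord (Num.trunc (`|tnth x i| / net_step)))].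

Definition net : {set net_code} :=
  [set z | `[< exists2 x, l2norm x <= 1 & round_code x = z >]].

Let s0 : 0 < Num.sqrt d%:R :> R.
Proof. by rewrite sqrtr_gt0 ltr0n. Qed.

Lemma net_step_gt0 : 0 < net_step.
Proof. by rewrite divr_gt0. Qed.

Lemma tnth_le1 (x : d.-tuple R) i : l2norm x <= 1 -> `|tnth x i| <= 1.
Proof.
rewrite l2norm_le1 => x1.
rewrite -(ler_pXn2r (n := 2))// ?nnegrE// expr1n -normrX ger0_norm ?sqr_ge0//.
rewrite (le_trans _ x1)// (bigD1 i)//= lerDl sumr_ge0// => j _; exact: sqr_ge0.
Qed.

Lemma round_code_val (x : d.-tuple R) i : l2norm x <= 1 ->
  (round_code x i).2 = Num.trunc (`|tnth x i| / net_step) :> nat.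
Proof.
move=> x1; rewrite ffunE /= inordK// ltnS le_truncn//.
by rewrite ler_pdivrMr ?net_step_gt0// mulVf ?gt_eqF ?net_step_gt0// tnth_le1.
Qed.

Lemma round_trunc (x : d.-tuple R) i : l2norm x <= 1 ->
  net_step * ((round_code x i).2 : nat)%:R <= `|tnth x i| <
  net_step * ((round_code x i).2 : nat)%:R + net_step.
Proof.
move=> x1; rewrite round_code_val//.
have /andP[] : (Num.trunc (`|tnth x i| / net_step))%:R <=
    `|tnth x i| / net_step <
    (Num.trunc (`|tnth x i| / net_step)).+1%:R.
  by rewrite truncn_itv// divr_ge0// ltW// net_step_gt0.
rewrite ler_pdivlMr ?net_step_gt0// ltr_pdivrMr ?net_step_gt0//.
by rewrite -natr1 mulrDl mul1r mulrC => -> ->.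
Qed.

Lemma net_point_round (x : d.-tuple R) i :
  tnth (net_point (round_code x)) i =
  (-1) ^+ (tnth x i < 0)%R * (net_step * ((round_code x i).2 : nat)%:R).
Proof. by rewrite tnth_mktuple ffunE. Qed.

Lemma round_dist (x : d.-tuple R) : l2norm x <= 1 ->
  l2norm (tuple_sub (net_point (round_code x)) x) ^+ 2 <= r ^+ 2.
Proof.
move=> x1; rewrite sqr_tuple_sub.
have -> : r ^+ 2 = \sum_(i < d) net_step ^+ 2.
  rewrite sumr_const card_ord -mulr_natl expr_div_n sqr_sqrtr//.
  by field; rewrite pnatr_eq0 -lt0n.
apply: ler_sum => i _; rewrite net_point_round.
have st0 := net_step_gt0.
have /andP[] := round_trunc i x1; set u := net_step * _ => h1 h2.
rewrite -[leRHS]ger0_norm ?sqr_ge0// -[leLHS]ger0_norm ?sqr_ge0// !normrX.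
rewrite ler_pXn2r ?nnegrE// [leRHS]ger0_norm ?(ltW net_step_gt0)//.
move: h1 h2; case: (ltP (tnth x i) 0) => x0;
  rewrite ?(ltr0_norm x0) ?(ger0_norm x0) => h1 h2;
  rewrite /= ?expr1 ?expr0 ler_norml; apply/andP; split; lra.
Qed.

Lemma net_point_le1 z : z \in net -> l2norm (net_point z) <= 1.
Proof.
rewrite inE => /asboolP[x x1 <-]; have := x1.
rewrite !l2norm_le1; apply: le_trans; apply: ler_sum => i _.
rewrite -[leRHS]ger0_norm ?sqr_ge0// -[leLHS]ger0_norm ?sqr_ge0// !normrX.
rewrite ler_pXn2r ?nnegrE// net_point_round normrM normr_sign mul1r.
have /andP[h _] := round_trunc i x1.
by rewrite [leLHS]ger0_norm // mulr_ge0 // ltW // net_step_gt0.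
Qed.

(** Cauchy-Schwarz in the form of AM-GM: each term is at most sqrt(d) |x_i| <= (d x_i^2 + 1) / 2. *)
Lemma round_code_l1 (x : d.-tuple R) : l2norm x <= 1 ->
  \sum_(i < d) r * ((round_code x i).2 : nat)%:R <= d%:R.
Proof.
move=> x1.
apply: (@le_trans _ _ (\sum_(i < d) (d%:R * tnth x i ^+ 2 + 1) / 2)).
  apply: ler_sum => i _; have /andP[h _] := round_trunc i x1.
  have : r * ((round_code x i).2 : nat)%:R <= Num.sqrt d%:R * `|tnth x i|.
    have -> : r * ((round_code x i).2 : nat)%:R =
        Num.sqrt d%:R * (net_step * ((round_code x i).2 : nat)%:R).
      by rewrite /net_step; field; rewrite gt_eqF.
    by rewrite ler_wpM2l// sqrtr_ge0.
  move/le_trans; apply; have := sqr_ge0 (Num.sqrt d%:R * `|tnth x i| - 1).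
  have -> : tnth x i ^+ 2 = `|tnth x i| ^+ 2.
    by rewrite -normrX ger0_norm ?sqr_ge0.
  have ds : d%:R = Num.sqrt d%:R ^+ 2 :> R by rewrite sqr_sqrtr.
  move: ds; set s := Num.sqrt d%:R => ->; lra.
rewrite -mulr_suml big_split/= -mulr_sumr sumr_const card_ord.
move: x1; rewrite l2norm_le1 => x1.
rewrite ler_pdivrMr// mulr_natr mulr2n lerD2r.
by rewrite -[leRHS]mulr1 ler_wpM2l.
Qed.

(* Every code z in the net satisfies r * |z|_1 <= d, so its cardinality is at
   most the sum of exp (d - r |z|_1) over all codes, a product over coordinates. *)
Lemma card_net : #|net|%:R <= (4 * expR 1 / r) ^+ d.
Proof.
pose q : R := expR (- r).
have q0 : 0 < 1 - q by rewrite subr_gt0 expR_lt1 oppr_lt0.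
(* Average 1 - q >= r q and 1 - q >= r - r q; the second uses r <= 1. *)
have q1 : r / 2 <= 1 - q.
  have : (1 + r) * q <= 1.
    by rewrite -[leRHS](expRxMexpNx_1 r) ler_wpM2r ?expR_ge0 ?expR_ge1Dx.
  have : 0 <= (1 - q) * (1 - r) by rewrite mulr_ge0 ?(ltW q0)// subr_ge0.
  lra.
pose F (c : bool * 'I_(Num.trunc (net_step^-1)).+1) : R :=
  expR 1 * q ^+ (c.2 : nat).
have F0 c : 0 <= F c by rewrite mulr_ge0 ?exprn_ge0 ?expR_ge0.
have sumF : \sum_c F c <= 4 * expR 1 / r.
  rewrite /F -mulr_sumr.
  rewrite -(pair_bigA _ (fun b (j : 'I__) => q ^+ (j : nat))) /=.
  rewrite sumr_const card_bool.
  set S := \sum_(j < _) _.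
  have S0 : 0 <= S by apply: sumr_ge0 => j _; rewrite exprn_ge0 ?expR_ge0.
  have S1 : (1 - q) * S <= 1.
    have -> : (1 - q) * S = 1 - q ^+ (Num.trunc (net_step^-1)).+1.
      by rewrite -[RHS]opprB subrX1 -mulNr opprB.
    by rewrite gerBl exprn_ge0 ?expR_ge0.
  have S2 : S <= 2 / r.
    rewrite ler_pdivlMr//.
    have : r / 2 * S <= (1 - q) * S by rewrite ler_wpM2r.
    lra.
  (* The two signs double the geometric sum, itself at most 2 / r. *)
  have -> : 4 * expR 1 / r = expR 1 * (2 / r *+ 2) :> R.
    by rewrite -mulr_natl; field; rewrite gt_eqF.
  by rewrite ler_wpM2l ?expR_ge0// lerMn2r S2.
have -> : #|net|%:R = \sum_(z in net) (1 : R) by rewrite sumr_const.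
apply: (@le_trans _ _ (\sum_(z : net_code) \prod_i F (z i))).
  rewrite [leRHS](bigID (mem net))/= ler_wpDr ?sumr_ge0// => [z _|].
    by rewrite prodr_ge0.
  apply: ler_sum => z; rewrite inE => /asboolP[x x1 <-].
  rewrite (eq_bigr (fun i => expR (1 - r * ((round_code x i).2 : nat)%:R))).
    rewrite -expR_sum -[leLHS]expR0 ler_expR sumrB sumr_const card_ord subr_ge0.
    exact: round_code_l1.
  by move=> i _; rewrite /F /q expRD -mulNr expRM_natr.
rewrite -(bigA_distr_bigA (fun=> F)) prodr_const card_ord.
by rewrite lerXn2r// nnegrE ?sumr_ge0// divr_ge0 ?mulr_ge0 ?expR_ge0// ltW.
Qed.
End net.

(** * The randomizer *)

Section blanket_randomizer.
Context {R : realType}.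

(* [Some c] is the blanket sample [c], [None] the truthful report. *)
Definition blanket_weight (J : finType) (p : R) (o : option J) : R :=
  if o is Some _ then p / #|J|%:R else 1 - p.

Lemma blanket_weight_ge0 (J : finType) (p : R) : 0 <= p -> p <= 1 ->
  forall o : option J, 0 <= blanket_weight p o.
Proof. by move=> p0 p1 [c|] /=; rewrite ?divr_ge0 ?subr_ge0. Qed.

Lemma sum_blanket_weight (J : finType) (p : R) : (0 < #|J|)%N ->
  \sum_o blanket_weight (J := J) p o = 1.
Proof.
move=> J0; rewrite sum_option /= sumr_const -[_ *+ #|J|]mulr_natr divfK ?subrK//.
by rewrite pnatr_eq0 -lt0n.
Qed.

Lemma blanket_privacy (d : measure_display) (T : measurableType d) (J : finType)
    (pt : J -> T) (p : R) (K eps delta : R) (n : nat) (h h' : 'I_n -> J)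
    (i : 'I_n) (P P' : probability (n.-tuple T) R) :
  0 <= p -> p <= 1 -> 0 < eps -> eps <= K -> 0 < delta -> delta <= 2^-1 ->
  (1 < n)%N ->
  32 * (1 + expR (2 * K)) * ln (1 / delta) <= n%:R * (p / #|J|%:R) * eps ^+ 2 ->
  (forall l, l != i -> h l = h' l) ->
  (forall A, measurable A -> P A = (\sum_(s : {ffun 'I_n -> option J})
    (\prod_l blanket_weight p (s l)) * symmetrized_indic A (outcome pt h s))%:E) ->
  (forall A, measurable A -> P' A = (\sum_(s : {ffun 'I_n -> option J})
    (\prod_l blanket_weight p (s l)) * symmetrized_indic A (outcome pt h' s))%:E) ->
  forall A, measurable A -> (P A <= (expR eps)%:E * P' A + delta%:E)%E.
Proof.
move=> p0 p1 e0 eK d0 d2 n1 hn hh' PE PE' A mA.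
have w0 := @blanket_weight_ge0 J _ p0 p1.
have w1 : \sum_o blanket_weight (J := J) p o = 1.
  by apply: sum_blanket_weight; apply/card_gt0P; exists (h i).
have e1 : 1 <= expR eps by rewrite (le_trans _ (expR_ge1Dx _))//; lra.
rewrite PE// PE'// -EFinM -EFinD lee_fin.
(* Distinct inputs may round to the same net point; the exchange argument requires a != b. *)
have [hi|hi] := eqVneq (h i) (h' i).
  have -> : outcome pt h = outcome pt h'.
    apply/funext => s; apply: eq_from_tnth => l; rewrite !tnth_mktuple.
    by have [->|li] := eqVneq l i; rewrite ?hi// hh'.
  rewrite ler_wpDr ?(ltW d0)// ler_peMl// sumr_ge0// => s _.
  by rewrite mulr_ge0 ?prodr_ge0// symmetrized_indic_ge0.
apply: le_trans.
  apply: (blanket_le pt (q := p / #|J|%:R) w0 _ hi (f := symmetrized_indic A)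
    erefl erefl hh' _ _ e1) => //.
  - by move=> t y; exact: symmetrized_indic_permute.
  - by move=> y; rewrite symmetrized_indic_ge0 symmetrized_indic_le1.
rewrite lerD2l.
have lam0 : 0 <= chernoff_param K eps.
  by rewrite divr_ge0 ?(ltW e0)// mulr_ge0// addr_ge0// expR_ge0.
apply: le_trans.
  by apply: (blanket_chernoff i (q := p / #|J|%:R) w0 _ hi
    (lam := chernoff_param K eps)).
have lnd : ln (1 / delta) = - ln delta by rewrite div1r lnV// posrE.
rewrite -[leRHS](@lnK _ delta) ?posrE// ler_expR -[leRHS]opprK -lnd.
have lam2 := chernoff_param_le2V e0 eK.
have expo := chernoff_exponent_le e0 eK.
set q := p / _ in hn *; have q0 : 0 <= q by rewrite divr_ge0.
set L := 1 + _ in hn expo *.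
have L0 : 0 < L by rewrite addr_gt0// expR_gt0.
have lnd2 := ln_inv_ge d0 d2.
(* Only the n - 1 other users contribute; this costs a factor 2. *)
have n2 : n%:R <= 2 * n.-1%:R :> R.
  rewrite -natrM ler_nat -{1}(prednK (ltnW n1)) mul2n -addnn -addn1 leq_add2l.
  by rewrite -ltnS (prednK (ltnW n1)).
set X := _ - 2 in expo *.
have : n.-1%:R * (q * X) <= n.-1%:R * (q * - (eps ^+ 2 / (8 * L))).
  by rewrite !ler_wpM2l.
have : n%:R * q * eps ^+ 2 <= 2 * n.-1%:R * q * eps ^+ 2.
  by rewrite !ler_wpM2r ?sqr_ge0.
have -> : n.-1%:R * (q * - (eps ^+ 2 / (8 * L))) =
   - (2 * n.-1%:R * q * eps ^+ 2) / (16 * L) by field; rewrite gt_eqF.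
move=> h1 h2.
(* One of the two copies of log(1/delta) absorbs the additive lam <= 1/2; the other yields delta. *)
have h3 : 2 * ln (1 / delta) <= (2 * n.-1%:R * q * eps ^+ 2) / (16 * L).
  rewrite ler_pdivlMr ?mulr_gt0//; lra.
lra.
Qed.

Section net_randomizer.
Variables (d : nat) (r : R).
Hypotheses (d_gt0 : (0 < d)%N) (r_gt0 : 0 < r).

Definition net_type : finType := {z : net_code d r | z \in net d r}.

Lemma round_code_net (x : unit_ball R d) : round_code r (sval x) \in net d r.
Proof. by rewrite inE; apply/asboolP; exists (sval x) => //; exact: (svalP x). Qed.

Definition nearest (x : unit_ball R d) : net_type :=
  exist _ (round_code r (sval x)) (round_code_net x).

Definition net_value (z : net_type) : d.-tuple R := net_point (sval z).

Lemma l2norm_zero : l2norm [tuple (0 : R) | i < d] <= 1.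
Proof.
by rewrite l2norm_le1 big1// => i _; rewrite tnth_mktuple expr0n.
Qed.

Lemma card_net_type_gt0 : (0 < #|net_type|)%N.
Proof.
apply/card_gt0P.
by exists (nearest (exist (fun x => is_true (l2norm x <= 1)) _ l2norm_zero)).
Qed.

Lemma card_net_type : #|net_type| = #|net d r|.
Proof. by rewrite card_sig; apply: eq_card. Qed.

Variable p : R.
Hypotheses (p_ge0 : 0 <= p) (p_le1 : p <= 1).

Definition net_randomizer : randomizer R d := fun x =>
  finite_law None (fun o => net_value (odflt (nearest x) o))
    (@blanket_weight_ge0 net_type _ p_ge0 p_le1)
    (sum_blanket_weight p card_net_type_gt0).

Lemma shuffled_net_randomizerE n (X : n.-tuple (unit_ball R d)) A :
  measurable A ->
  shuffled_output net_randomizer X A =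
  (\sum_(s : {ffun 'I_n -> option net_type}) (\prod_l blanket_weight p (s l)) *
    symmetrized_indic A (outcome net_value (fun i => nearest (tnth X i)) s))%:E.
Proof.
apply: shuffle_law_finiteE => B mB.
exact: (product_finite_lawE _ _ _
  (fun i o => net_value (odflt (nearest (tnth X i)) o))).
Qed.

(** A truthful report errs by at most r; a blanket sample lies in the ball, at squared distance at
    most 4, and has total weight p. *)
Lemma net_randomizer_mse (x : unit_ball R d) :
  (mean_squared_error net_randomizer x <= (r ^+ 2 + 4 * p)%:E)%E.
Proof.
rewrite /mean_squared_error unlock integral_finite_law; last 2 first.
- by apply/measurable_EFinP; exact: measurable_sqr_tuple_sub.
- by move=> z; rewrite lee_fin sqr_ge0.
rewrite (eq_bigr (fun o => (blanket_weight p o * l2norm (tuple_sub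
  (net_value (odflt (nearest x) o)) (sval x)) ^+ 2)%:E)); last first.
  by move=> o _; rewrite EFinM.
rewrite sumEFin lee_fin sum_option /=.
have x1 : l2norm (sval x) <= 1 := svalP x.
apply: lerD.
  rewrite (le_trans (ler_piMl _ _)) ?sqr_ge0// ?gerBl//.
  exact: round_dist.
apply: (@le_trans _ _ (\sum_(c : net_type) p / #|net_type|%:R * 4)).
  apply: ler_sum => c _; rewrite ler_wpM2l ?divr_ge0// sqr_tuple_sub_le4//.
  by apply: net_point_le1 => //; exact: (svalP c).
rewrite -mulr_suml sumr_const -[_ *+ #|_|]mulr_natr divfK 1?mulrC//.
by rewrite pnatr_eq0 -lt0n card_net_type_gt0.
Qed.

End net_randomizer.
End blanket_randomizer.

(** * Indistinguishability and choice of the radius *)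

Lemma net_randomizer_indistinguishable (R : realType) (d n : nat)
    (r p K eps delta : R)
    (p0 : 0 <= p) (p1 : p <= 1) (X X' : n.-tuple (unit_ball R d)) :
  0 < eps -> eps <= K -> 0 < delta -> delta <= 2^-1 -> (1 < n)%N ->
  32 * (1 + expR (2 * K)) * ln (1 / delta) <=
    n%:R * (p / #|net d r|%:R) * eps ^+ 2 ->
  neighboring X X' ->
  indistinguishable eps delta (shuffled_output (net_randomizer r p0 p1) X)
    (shuffled_output (net_randomizer r p0 p1) X').
Proof.
move=> e0 eK dl0 dl2 n1; rewrite -card_net_type => hn [i [_ XX']].
rewrite /indistinguishable ge_max; apply/andP; split; apply: hockey_stick_le.
  apply: (blanket_privacy (i := i) p0 p1 e0 eK dl0 dl2 n1 hn _
    (shuffled_net_randomizerE r p0 p1 X) (shuffled_net_randomizerE r p0 p1 X')).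
  by move=> l /XX' ->.
apply: (blanket_privacy (i := i) p0 p1 e0 eK dl0 dl2 n1 hn _
    (shuffled_net_randomizerE r p0 p1 X') (shuffled_net_randomizerE r p0 p1 X)).
by move=> l /XX' ->.
Qed.

Theorem theorem6p3 (R : realType) (K : R) :
  exists2 C : R, 0 < C &
    forall (d n : nat) (eps_c delta : R),
      (1 <= d)%N ->
      0 < eps_c -> eps_c <= K ->
      0 < delta -> delta <= 2^-1 ->
      Num.max (16 * ln (1 / delta))
        (2 ^+ (d + 7) * ln (1 / delta) / (expR eps_c - 1) ^+ 2) < n%:R ->
      exists A : randomizer R d,
        (forall X X' : n.-tuple (unit_ball R d), neighboring X X' ->
           indistinguishable eps_c delta
             (shuffled_output A X) (shuffled_output A X')) /\
        (ereal_sup (range (mean_squared_error A)) <=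
           (C * (ln (1 / delta) / (n%:R * eps_c ^+ 2))
                  `^ (2 / (d%:R + 2)))%:E)%E.
Proof.
(* [c] comes from [card_net], [M] from the hypothesis of [blanket_privacy]; neither depends on d. *)
pose c : R := 4 * expR 1; pose M : R := 32 * (1 + expR (2 * K)).
have c1 : 1 <= c by have := expR_ge1Dx (1 : R); rewrite /c; lra.
have M1 : 1 <= M by have := expR_ge0 (2 * K); rewrite /M; lra.
have c0 : 0 < c by lra.
have M0 : 0 < M by lra.
exists (5 * (c * M) ^+ 2); first by rewrite mulr_gt0// exprn_gt0// mulr_gt0.
move=> d n eps delta d1 e0 eK dl0 dl2; rewrite gt_max => /andP[n16 _].
have L2 := ln_inv_ge dl0 dl2.
(* Here n > 16 log(1/delta) >= 8. *)
have n1 : (1 < n)%N by rewrite -(ltr_nat R); lra.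
set L := ln (1 / delta) in L2 n16 *.
have L0 : 0 < L by lra.
have ne0 : 0 < n%:R * eps ^+ 2.
  by rewrite mulr_gt0 ?exprn_gt0// ltr0n (ltn_trans _ n1).
set t := L / _; have t0 : 0 < t by rewrite divr_gt0.
pose u := t `^ (d%:R + 2)^-1.
have u0 : 0 < u by exact: powR_gt0.
have ud : u ^+ d.+2 = t.
  rewrite -powR_mulrn ?(ltW u0)// -powRrM -(addn2 d) natrD.
  by rewrite mulVf ?powRr1 ?(ltW t0)//.
have u2 : t `^ (2 / (d%:R + 2)) = u ^+ 2.
  by rewrite -powR_mulrn ?(ltW u0)// -powRrM mulrC.
rewrite u2.
pose r := c * M * u.
have r0 : 0 < r by rewrite !mulr_gt0.
have -> : 5 * (c * M) ^+ 2 * u ^+ 2 = 5 * r ^+ 2 by rewrite -mulrA -exprMn.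
(* For r > 1 the constant output 0 has error at most 4 <= 5 r^2, and its shuffled law is the same
   for all datasets. *)
have [r1|r1] := leP r 1; last first.
  exists (fun=> \d_[tuple (0 : R) | i < d]); split.
    move=> X X' _; rewrite /indistinguishable.
    set P := shuffled_output _ X; set P' := shuffled_output _ X'.
    have -> : P' = P by [].
    rewrite maxxx; apply: hockey_stick_le => A mA.
    apply: lee_paddr; first by rewrite lee_fin ltW.
    apply: lee_pemull => //; rewrite lee_fin.
    by rewrite (le_trans _ (expR_ge1Dx _))//; lra.
  apply: ge_ereal_sup => _ [x _ <-].
  rewrite /mean_squared_error unlock integral_dirac//; last first.
    by apply/measurable_EFinP; exact: measurable_sqr_tuple_sub.
  rewrite diracT mul1e lee_fin.
  have h4 : l2norm (tuple_sub [tuple (0 : R) | i < d] (sval x)) ^+ 2 <= 4.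
    by apply: sqr_tuple_sub_le4; [exact: l2norm_zero|exact: (svalP x)].
  have : 1 <= r ^+ 2 by rewrite exprn_ege1// ltW.
  lra.
(* Blanket probability p = r^2 balances the two error terms: r^2 + 4 p = 5 r^2. *)
have p0 : 0 <= r ^+ 2 by exact: sqr_ge0.
have p1 : r ^+ 2 <= 1 by rewrite expr_le1// ltW.
exists (net_randomizer r p0 p1); split.
  move=> X X'; apply: (net_randomizer_indistinguishable p0 p1 e0 eK dl0 dl2 n1).
  have k0 : 0 < #|net d r|%:R :> R.
    by rewrite ltr0n -card_net_type card_net_type_gt0.
  (* By [card_net] this reduces to M t c^d <= r^(d+2) = (c M)^(d+2) t, which holds as c, M >= 1. *)
  have hk : M * t * #|net d r|%:R <= r ^+ 2.
    apply: (@le_trans _ _ (M * t * (c / r) ^+ d)).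
      by rewrite ler_wpM2l ?card_net// mulr_ge0// ltW.
    rewrite expr_div_n mulrA ler_pdivrMr ?exprn_gt0// -exprD add2n.
    rewrite [r ^+ _]exprMn ud mulrAC ler_wpM2r ?(ltW t0)//.
    rewrite [leRHS](exprMn d.+2 c M) [leRHS]mulrC.
    apply: ler_pM; rewrite ?exprn_ge0 ?(ltW c0) ?(ltW M0)//.
      exact: ler_eXnr.
    by apply: ler_weXn2l => //; exact: leqW.
  rewrite -/M -/L [leRHS]mulrAC.
  have -> : M * L = n%:R * eps ^+ 2 * (M * t).
    by rewrite /t mulrCA; congr (_ * _); rewrite mulrC divfK// gt_eqF.
  by rewrite ler_wpM2l ?(ltW ne0)// ler_pdivlMr.
apply: ge_ereal_sup => _ [x _ <-].
apply: (le_trans (net_randomizer_mse d1 r0 p0 p1 x)).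
by rewrite lee_fin; lra.
Qed.
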